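(* Let $\mathbb{K}$ be a field and let $\mathcal{C}$ be a small connected category. Every functor $M:\mathcal{C}\to\mathrm{Vect}_{\mathbb{K}}$ decomposes as $$M\cong(\mathbb{K}_{\mathcal{C}})^{\operatorname{rk}M}\oplus N$$ for some functor $N:\mathcal{C}\to\mathrm{Vect}_{\mathbb{K}}$ with $\operatorname{im}\Psi_N=0$.
   Context: $\mathrm{Vect}_{\mathbb{K}}$ is the category of $\mathbb{K}$-vector spaces. A category is connected if it is non-empty and any two objects are joined by a finite zigzag of morphisms. For $M:\mathcal{C}\to\mathrm{Vect}_{\mathbb{K}}$ with universal cone $(\lambda_c:\lim M\to M(c))_{c\in\mathcal{C}}$ and universal cocone $(\gamma_c:M(c)\to\operatorname{colim}M)_{c\in\mathcal{C}}$, the canonical limit-to-colimit map is $\Psi_M:=\gamma_c\circ\lambda_c:\lim M\to\operatorname{colim}M$ for any object $c$ (independent of $c$ since $\mathcal{C}$ is connected). The generalized rank is $\operatorname{rk}M:=\dim_{\mathbb{K}}\operatorname{im}\Psi_M$, a possibly infinite cardinal. $\mathbb{K}_{\mathcal{C}}$ is the constant functor with value $\mathbb{K}$ on objects and $\mathrm{id}_{\mathbb{K}}$ on morphisms; $(\mathbb{K}_{\mathcal{C}})^{\kappa}$ denotes the (pointwise) direct sum of $\kappa$ copies, i.e. the constant functor on a $\kappa$-dimensional vector space. *)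

(* Defs.v *)
From HB Require Import structures.
From Stdlib Require Import Relations.
From mathcomp Require Import all_boot all_order all_algebra.
From mathcomp Require Import all_classical.
Set Implicit Arguments.
Unset Strict Implicit.
Unset Printing Implicit Defensive.
Import GRing.Theory.
Local Open Scope classical_set_scope.
Local Open Scope ring_scope.

(* An object of Vect_K is an [lmodType K] and a morphism is a
   [{linear U -> V}].  Smallness is a universe constraint: [vlim] and [vcolim]
   can only be formed when the objects of the category live in the universe of
   the carriers of K-vector spaces. *)

Section Subspaces.
Variables (K : fieldType) (V : lmodType K).

Record submod (S : submodClosed V) :=
  Submod { submod_val : V; submod_valP : submod_val \in S }.

HB.instance Definition _ (S : submodClosed V) := [isSub for @submod_val S].
HB.instance Definition _ (S : submodClosed V) := [Choice of submod S by <:].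
HB.instance Definition _ (S : submodClosed V) :=
  [SubChoice_isSubLmodule of submod S by <:].

Lemma submod_val_is_linear (S : submodClosed V) : linear (@submod_val S).
Proof. exact: (linearP (\val : submod S -> V)). Qed.

HB.instance Definition _ (S : submodClosed V) :=
  GRing.isLinear.Build K (submod S) V *:%R (@submod_val S)
    (@submod_val_is_linear S).

Definition lin_span (A : set V) : {pred V} := fun v =>
  `[< exists s : seq (K * V),
        (forall p, p \in s -> A p.2) /\ v = \sum_(p <- s) p.1 *: p.2 >].

Lemma lin_spanP (A : set V) v :
  reflect (exists s : seq (K * V),
     (forall p, p \in s -> A p.2) /\ v = \sum_(p <- s) p.1 *: p.2)
    (v \in lin_span A).
Proof. exact: asboolP. Qed.

Lemma mem_lin_span (A : set V) v : A v -> v \in lin_span A.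
Proof.
move=> Av; apply/lin_spanP; exists [:: (1, v)]; split.
  by move=> p; rewrite inE => /eqP ->.
by rewrite big_seq1 scale1r.
Qed.

Lemma lin_span_submod (A : set V) : submod_closed (lin_span A).
Proof.
split; first by apply/lin_spanP; exists [::]; rewrite big_nil.
move=> a u v /lin_spanP[s [sA ->]] /lin_spanP[t [tA ->]]; apply/lin_spanP.
exists ([seq (a * p.1, p.2) | p <- s] ++ t); split.
  move=> p; rewrite mem_cat => /orP[/mapP[q qs ->]|]; [exact: (sA _ qs)|exact: tA].
rewrite big_cat big_map scaler_sumr; congr (_ + _).
by apply: eq_bigr => p _; rewrite scalerA.
Qed.

HB.instance Definition _ (A : set V) :=
  GRing.isSubmodClosed.Build K V (lin_span A) (lin_span_submod A).

Lemma lin_span_min (A : set V) (S : submodClosed V) :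
  (forall v, A v -> v \in S) -> forall v, v \in lin_span A -> v \in S.
Proof.
move=> AS v /lin_spanP[s [sA ->]]; rewrite big_seq; apply: rpred_sum => p ps.
by apply/rpredZ/AS/sA.
Qed.

End Subspaces.

(* The quotient of V by the subspace spanned by A. *)
Section Quotients.
Variables (K : fieldType) (V : lmodType K) (A : set V).

Definition qspan : Type := Quotient.quot (lin_span A).

HB.instance Definition _ := GRing.Zmodule.on qspan.

Definition qpi (v : V) : qspan := \pi_(Quotient.quot (lin_span A))%qT v.

Lemma qpi_eq u v : qpi u = qpi v <-> u - v \in lin_span A.
Proof. by rewrite Quotient.idealrBE; split=> [e|/eqP//]; exact/eqP. Qed.

Lemma qpi_is_zmod_morphism : zmod_morphism qpi.
Proof. by move=> u v; rewrite /qpi raddfB. Qed.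

HB.instance Definition _ :=
  GRing.isZmodMorphism.Build V qspan qpi qpi_is_zmod_morphism.

Definition qrepr (q : qspan) : V := repr (q : Quotient.quot (lin_span A)).

Lemma qreprK : cancel qrepr qpi.
Proof. by move=> q; rewrite /qpi reprK. Qed.

Definition qscale (a : K) (q : qspan) : qspan := qpi (a *: qrepr q).

Lemma qscaleE a v : qscale a (qpi v) = qpi (a *: v).
Proof.
by apply/qpi_eq; rewrite -scalerBr rpredZ//; apply/qpi_eq; rewrite qreprK.
Qed.

Lemma qscaleA a b q : qscale a (qscale b q) = qscale (a * b) q.
Proof. by rewrite -(qreprK q) !qscaleE scalerA. Qed.

Lemma qscale1 : left_id 1 qscale.
Proof. by move=> q; rewrite -(qreprK q) qscaleE scale1r. Qed.

Lemma qscaleDr : right_distributive qscale +%R.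
Proof.
move=> a p q; rewrite -(qreprK p) -(qreprK q).
by rewrite -raddfD !qscaleE -raddfD scalerDr.
Qed.

Lemma qscaleDl q : {morph (fun a => qscale a q) : a b / a + b}.
Proof. by move=> a b; rewrite -(qreprK q) !qscaleE -raddfD scalerDl. Qed.

HB.instance Definition _ :=
  GRing.Zmodule_isLmodule.Build K qspan qscaleA qscale1 qscaleDr qscaleDl.

Lemma qpi_is_scalable : scalable qpi.
Proof. by move=> a v; rewrite -qscaleE. Qed.

HB.instance Definition _ :=
  GRing.isScalable.Build K V qspan *:%R qpi qpi_is_scalable.

Lemma qspan_lift (W : lmodType K) (g : {linear V -> W}) :
  (forall v, A v -> g v = 0) ->
  exists h : {linear qspan -> W}, forall v, h (qpi v) = g v.
Proof.
move=> gA; pose h q := g (qrepr q).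
have hE v : h (qpi v) = g v.
  apply/eqP; rewrite -subr_eq0 -linearB; apply/eqP.
  have /qpi_eq/lin_spanP[s [sA ->]] := qreprK (qpi v).
  rewrite linear_sum big_seq big1// => p ps.
  by rewrite linearZ /= gA ?scaler0//; exact: sA.
have h_lin : linear h.
  move=> a p q; rewrite -(qreprK p) -(qreprK q).
  by rewrite -linearP !hE linearP.
pose hL := GRing.isLinear.Build K qspan W *:%R h h_lin.
by exists (HB.pack_for {linear qspan -> W} h hL).
Qed.

End Quotients.

Section Image.
Variables (K : fieldType) (U V : lmodType K) (f : {linear U -> V}).

Definition in_img : {pred V} := fun v => v \in range f.

Lemma img_submod : submod_closed in_img.
Proof.
split; first by apply/mem_set; exists 0 => //; rewrite linear0.
move=> a _ _ /set_mem[u _ <-] /set_mem[v _ <-]; apply/mem_set.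
by exists (a *: u + v) => //; rewrite linearP.
Qed.

HB.instance Definition _ := GRing.isSubmodClosed.Build K V in_img img_submod.

Definition img : lmodType K := submod in_img.

End Image.

Section Families.
Variables (K : fieldType) (I : Type) (V : I -> lmodType K).

Definition prodmod : Type := forall i, V i.

HB.instance Definition _ := gen_eqMixin prodmod.
HB.instance Definition _ := gen_choiceMixin prodmod.

Definition prodmod_add (x y : prodmod) : prodmod := fun i => x i + y i.
Definition prodmod_opp (x : prodmod) : prodmod := fun i => - x i.
Definition prodmod_zero : prodmod := fun i => 0.
Definition prodmod_scale (a : K) (x : prodmod) : prodmod := fun i => a *: x i.

Lemma prodmod_addA : associative prodmod_add.
Proof. by move=> x y z; apply: functional_extensionality_dep => i; exact: addrA. Qed.
Lemma prodmod_addC : commutative prodmod_add.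
Proof. by move=> x y; apply: functional_extensionality_dep => i; exact: addrC. Qed.
Lemma prodmod_add0 : left_id prodmod_zero prodmod_add.
Proof. by move=> x; apply: functional_extensionality_dep => i; exact: add0r. Qed.
Lemma prodmod_addN : left_inverse prodmod_zero prodmod_opp prodmod_add.
Proof. by move=> x; apply: functional_extensionality_dep => i; exact: addNr. Qed.

HB.instance Definition _ := GRing.isZmodule.Build prodmod
  prodmod_addA prodmod_addC prodmod_add0 prodmod_addN.

Lemma prodmod_scaleA a b x :
  prodmod_scale a (prodmod_scale b x) = prodmod_scale (a * b) x.
Proof. by apply: functional_extensionality_dep => i; exact: scalerA. Qed.
Lemma prodmod_scale1 : left_id 1 prodmod_scale.
Proof. by move=> x; apply: functional_extensionality_dep => i; exact: scale1r. Qed.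
Lemma prodmod_scaleDr : right_distributive prodmod_scale +%R.
Proof. by move=> a x y; apply: functional_extensionality_dep => i; exact: scalerDr. Qed.
Lemma prodmod_scaleDl x : {morph (fun a => prodmod_scale a x) : a b / a + b}.
Proof. by move=> a b; apply: functional_extensionality_dep => i; exact: scalerDl. Qed.

HB.instance Definition _ := GRing.Zmodule_isLmodule.Build K prodmod
  prodmod_scaleA prodmod_scale1 prodmod_scaleDr prodmod_scaleDl.

Lemma prodmodP (x y : prodmod) : (forall i, x i = y i) -> x = y.
Proof. exact: functional_extensionality_dep. Qed.

Lemma prodmodZE a (x : prodmod) i : (a *: x) i = a *: x i.
Proof. by []. Qed.
Lemma prodmodDE (x y : prodmod) i : (x + y) i = x i + y i.
Proof. by []. Qed.
Lemma prodmodBE (x y : prodmod) i : (x - y) i = x i - y i.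
Proof. by []. Qed.

Definition fin_supp : {pred prodmod} := fun x =>
  `[< finite_set [set i | x i != 0] >].

Lemma fin_supp_submod : submod_closed fin_supp.
Proof.
split.
  apply/asboolP; rewrite (_ : [set _ | _] = set0) ?finite_set0//.
  by apply/seteqP; split=> i //=; rewrite eqxx.
move=> a x y /asboolP fx /asboolP fy; apply/asboolP.
have : finite_set ([set i | x i != 0] `|` [set i | y i != 0]).
  by rewrite finite_setU.
apply: sub_finite_set => i /=; rewrite prodmodDE prodmodZE.
have [->|] := eqVneq (x i) 0; last by left.
by rewrite scaler0 add0r; right.
Qed.

HB.instance Definition _ :=
  GRing.isSubmodClosed.Build K prodmod fin_supp fin_supp_submod.

Definition dsum : lmodType K := submod fin_supp.

Definition dsum_coef (x : dsum) : forall i, V i := submod_val x.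

Lemma dsumP (x y : dsum) : (forall i, dsum_coef x i = dsum_coef y i) -> x = y.
Proof. by move=> xy; apply/val_inj/prodmodP. Qed.

Definition dinj_fun i (v : V i) : prodmod := fun j =>
  if pselect (i = j) is left e then eq_rect i V v j e else 0.

Lemma dinj_funE i (v : V i) : dinj_fun v i = v.
Proof.
by rewrite /dinj_fun; case: pselect => // e; rewrite (Prop_irrelevance e erefl).
Qed.

Lemma dinj_funN i j (v : V i) : i <> j -> dinj_fun v j = 0.
Proof. by rewrite /dinj_fun; case: pselect. Qed.

Lemma dinj_finite i (v : V i) : dinj_fun v \in fin_supp.
Proof.
apply/asboolP; apply: (@sub_finite_set _ _ [set i]); last exact: finite_set1.
move=> j /=; have [ij _|ij] := pselect (i = j); first exact: esym.
by rewrite dinj_funN// eqxx.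
Qed.

Definition dinj i (v : V i) : dsum := Submod (dinj_finite v).

Lemma dinj_is_linear i : linear (@dinj i).
Proof.
move=> a u v; apply: dsumP => j.
rewrite /dsum_coef linearP /= prodmodDE prodmodZE /dinj_fun.
case: pselect => [e|]; last by rewrite scaler0 addr0.
by case: j / e.
Qed.

HB.instance Definition _ i :=
  GRing.isLinear.Build K (V i) dsum *:%R (@dinj i) (@dinj_is_linear i).

Lemma dsum_decomp (x y : dsum) : exists s : seq {classic I},
  [/\ uniq s, forall i, i \notin s -> dsum_coef x i = 0
           & forall i, i \notin s -> dsum_coef y i = 0].
Proof.
have /asboolP fx := submod_valP x; have /asboolP fy := submod_valP y.
have /finite_seqP[s sE] : finite_set ([set i : {classic I} | dsum_coef x i != 0]
    `|` [set i : {classic I} | dsum_coef y i != 0]) by rewrite finite_setU.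
exists (undup s); split; first exact: undup_uniq.
- move=> i; rewrite mem_undup => si; apply/eqP/negP => /negP xi.
  by move/negP: si; apply; have : [set` s] i by rewrite -sE; left.
- move=> i; rewrite mem_undup => si; apply/eqP/negP => /negP xi.
  by move/negP: si; apply; have : [set` s] i by rewrite -sE; right.
Qed.

Lemma dsumE (x : dsum) (s : seq {classic I}) : uniq s ->
  (forall i, i \notin s -> dsum_coef x i = 0) ->
  x = \sum_(i <- s) dinj (dsum_coef x i).
Proof.
move=> us sx; apply: dsumP => j.
have -> : dsum_coef (\sum_(i <- s) dinj (dsum_coef x i)) j =
    \sum_(i <- s) dinj_fun (dsum_coef x i) j.
  elim: (s) => [|i t IH]; first by rewrite !big_nil.
  by rewrite !big_cons -IH.
have [js|/[dup]/sx ->] := boolP (j \in (s : seq {classic I})).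
  rewrite (bigD1_seq (j : {classic I}))//= dinj_funE big1 ?addr0// => i /eqP ij.
  by rewrite dinj_funN.
move=> js; rewrite big_seq big1// => i si.
by rewrite dinj_funN// => ij; rewrite -ij si in js.
Qed.

Lemma dsum_lift (W : lmodType K) (g : forall i, {linear V i -> W}) :
  exists h : {linear dsum -> W}, forall i (v : V i), h (dinj v) = g i v.
Proof.
pose h (x : dsum) := \sum_(i \in [set: {classic I}]) g i (dsum_coef x i).
have hE x (s : seq {classic I}) : uniq s ->
    (forall i, i \notin s -> dsum_coef x i = 0) ->
    h x = \sum_(i <- s) g i (dsum_coef x i).
  move=> us sx; rewrite fsbig_seq// /h; apply/esym/fsbig_widen => // i [_] /= /negP.
  by move=> /sx ->; rewrite linear0.
have h_lin : linear h.
  move=> a x y; have [s [us sx sy]] := dsum_decomp x y.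
  rewrite !(hE _ s)//; last first.
    move=> i si; rewrite /dsum_coef linearP /= prodmodDE prodmodZE.
    by rewrite [submod_val x i]sx// [submod_val y i]sy// scaler0 addr0.
  rewrite scaler_sumr -big_split; apply: eq_bigr => i _.
  by rewrite [dsum_coef (_ + _)]/dsum_coef linearP.
pose hL := GRing.isLinear.Build K dsum W *:%R h h_lin.
exists (HB.pack_for {linear dsum -> W} h hL) => i v /=.
rewrite (hE _ [:: i : {classic I}])// ?big_seq1; first by rewrite /dsum_coef /= dinj_funE.
by move=> j; rewrite inE => /eqP ji; rewrite /dsum_coef /= dinj_funN// => /esym.
Qed.

Lemma dsum_ext (W : lmodType K) (g h : {linear dsum -> W}) :
  (forall i (v : V i), g (dinj v) = h (dinj v)) -> g =1 h.
Proof.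
move=> gh x; have [s [us sx _]] := dsum_decomp x x.
by rewrite (dsumE us sx) !linear_sum; apply: eq_bigr.
Qed.

End Families.

Section Dimension.
Variables (K : fieldType) (V : lmodType K).

Definition lin_indep (A : set V) := forall (s : seq V) (a : V -> K),
  uniq s -> (forall v, v \in s -> A v) -> \sum_(v <- s) a v *: v = 0 ->
  forall v, v \in s -> a v = 0.

Definition is_basis (B : set V) :=
  lin_indep B /\ forall v, v \in lin_span B.

Lemma lin_indepU1 (A : set V) v :
  lin_indep A -> v \notin lin_span A -> lin_indep (v |` A).
Proof.
move=> Ai vA s a us sA s0.
have sub w : w \in s -> w != v -> A w.
  by move=> /sA[-> /eqP|].
have rest : \sum_(w <- rem v s) a w *: w \in lin_span A.
  rewrite big_seq; apply: rpred_sum => w; rewrite mem_rem_uniq// inE => /andP[wv ws].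
  exact/rpredZ/mem_lin_span/sub.
have av : v \in s -> a v = 0.
  move=> vs; apply/eqP/negP => /negP av0; move/negP: vA; apply.
  have : a v *: v \in lin_span A.
    move: s0; rewrite (perm_big _ (perm_to_rem vs)) big_cons => /eqP.
    by rewrite addr_eq0 => /eqP ->; rewrite rpredN.
  by move=> /(rpredZ (a v)^-1); rewrite scalerA mulVf// scale1r.
have rem0 : \sum_(w <- rem v s) a w *: w = 0.
  have [vs|vs] := boolP (v \in s); last by rewrite rem_id.
  by move: s0; rewrite (perm_big _ (perm_to_rem vs)) big_cons /= av// scale0r add0r.
move=> w ws; have [wv|wv] := eqVneq w v; first by rewrite wv av// -wv.
apply: (Ai (rem v s) a) => //; first exact: rem_uniq.
- by move=> u; rewrite mem_rem_uniq// inE => /andP[uv us']; exact: sub.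
- by rewrite mem_rem_uniq// inE wv.
Qed.

Lemma basis_exists : exists B, is_basis B.
Proof.
have [|B [Bi Bmax]] := @Zorn_bigcup V lin_indep.
  move=> F Fi Ftot s a us sF s0.
  have [[X FX]|F0] := pselect (exists X, F X); last first.
    by move=> v /sF[X FX _]; case: F0; exists X.
  have [Y [FY sY]] : exists Y, F Y /\ forall v, v \in s -> Y v.
    elim: s sF {us s0} => [|v s IH] sF; first by exists X.
    have [|Y [FY sY]] := IH; first by move=> w ws; apply: sF; rewrite inE ws orbT.
    have [Z FZ Zv] := sF v (mem_head _ _).
    have [YZ|ZY] := Ftot _ _ FY FZ.
      exists Z; split=> // w; rewrite inE => /orP[/eqP->//|/sY]; exact: YZ.
    by exists Y; split=> // w; rewrite inE => /orP[/eqP->|/sY//]; exact: ZY.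
  exact: (Fi _ FY).
exists B; split=> // v; apply/negP => /negP vB.
apply: (Bmax (v |` B)); last exact: lin_indepU1.
split=> [w Bw|]; first by right.
by move=> /(_ v (or_introl erefl)) Bv; move/negP: vB; apply; exact: mem_lin_span.
Qed.

Lemma lin_indepS (A B : set V) : A `<=` B -> lin_indep B -> lin_indep A.
Proof. by move=> AB Bi s a us sA; apply: Bi => // v /sA; exact: AB. Qed.

Lemma lin_spanS (A B : set V) v :
  A `<=` B -> v \in lin_span A -> v \in lin_span B.
Proof.
by move=> AB; apply: (@lin_span_min _ _ A) => w Aw; exact/mem_lin_span/AB.
Qed.

Lemma lin_indep_notin (A : set V) v :
  lin_indep A -> A v -> v \notin lin_span (A `\ v).
Proof.
move=> Ai Av; apply/negP => /lin_spanP[s [sA vE]].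
pose t := undup [seq p.2 | p <- s].
pose a w : K := \sum_(p <- s | p.2 == w) p.1.
have tA w : w \in t -> (A `\ v) w.
  by rewrite mem_undup => /mapP[p ps ->]; exact: sA.
have vt : v \notin t by apply/negP => /tA[_]; exact.
have vE' : v = \sum_(w <- t) a w *: w.
  rewrite vE /t; under [RHS]eq_bigr do rewrite scaler_suml.
  rewrite (exchange_big_dep predT)//= big_seq [RHS]big_seq.
  apply: eq_bigr => p ps; under eq_bigl do rewrite eq_sym.
  rewrite -big_filter filter_pred1_uniq ?undup_uniq ?big_seq1//.
  by rewrite mem_undup map_f.
have := Ai (v :: t) (fun w => if w == v then -1 else a w).
rewrite /= vt undup_uniq => /(_ isT).
have wA w : w \in v :: t -> A w.
  by rewrite inE => /orP[/eqP->//|/tA[]].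
move=> /(_ wA); rewrite big_cons eqxx scaleN1r.
rewrite (_ : \sum_(_ <- t) _ = v); last first.
  rewrite [RHS]vE' big_seq [RHS]big_seq; apply: eq_bigr => w wt.
  by case: eqVneq => // wv; move: vt; rewrite -wv wt.
rewrite addNr => /(_ erefl v (mem_head _ _)); rewrite eqxx => /eqP.
by rewrite oppr_eq0 oner_eq0.
Qed.

Lemma basis_card_le (A B : set V) : lin_indep A -> is_basis B -> (A #<= B)%card.
Proof.
move=> Ai [_ Bspan].
pose mix (G : set (V * V)) : set V := fun v =>
  (exists a, G (a, v)) \/ (A v /\ forall b, ~ G (v, b)).
pose good (G : set (V * V)) :=
  [/\ forall a b, G (a, b) -> A a /\ B b,
      forall a b a' b', G (a, b) -> G (a', b') -> (a = a') <-> (b = b'),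
      forall a b, A b -> G (a, b) -> exists b', G (b, b')
    & lin_indep (mix G)].
have [|G [[GAB Ginj Gdisj Gind] Gmax]] := @Zorn_bigcup _ good.
  move=> F Fgood Ftot.
  have two p q : (\bigcup_(X in F) X) p -> (\bigcup_(X in F) X) q ->
      exists X, [/\ F X, X p & X q].
    move=> [X FX Xp] [Y FY Yq]; have [XY|YX] := Ftot _ _ FX FY.
      by exists Y; split=> //; exact: XY.
    by exists X; split=> //; exact: YX.
  split.
  - by move=> a b [X /Fgood[XAB _ _ _]]; exact: XAB.
  - move=> a b a' b' Fab Fab'; have [X [/Fgood[_ Xinj _ _] Xp Xq]] := two _ _ Fab Fab'.
    exact: Xinj.
  - move=> a b Ab [X FX Xab]; have [_ _ Xd _] := Fgood _ FX.
    by have [b' Xb'] := Xd _ _ Ab Xab; exists b', X.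
  - move=> s c us sF s0.
    have [[X0 FX0]|F0] := pselect (exists X, F X); last first.
      apply: (Ai s c) => // v /sF[[a [X FX _]]|[]//].
      by case: F0; exists X.
    have [X [FX sX]] : exists X, F X /\
        forall Y, F Y -> X `<=` Y -> forall v, v \in s -> mix Y v.
      elim: s sF {us s0} => [|v s IH] sF; first by exists X0.
      have [|X [FX sX]] := IH; first by move=> w ws; apply: sF; rewrite inE ws orbT.
      have [Z [FZ Zv]] : exists Z, F Z /\ forall Y, F Y -> Z `<=` Y -> mix Y v.
        have [[a [Z FZ Zav]]|[Av vN]] := sF v (mem_head _ _).
          by exists Z; split=> // Y FY ZY; left; exists a; exact: ZY.
        exists X0; split=> // Y FY _; right; split=> // b Yb.
        by apply: (vN b); exists Y.
      have [XZ|ZX] := Ftot _ _ FX FZ.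
        exists Z; split=> // Y FY ZY w; rewrite inE => /orP[/eqP->|ws]; first exact: Zv.
        by apply: sX => //; exact: subset_trans ZY.
      exists X; split=> // Y FY XY w; rewrite inE => /orP[/eqP->|ws]; last exact: sX.
      by apply: Zv => //; exact: subset_trans XY.
    have [_ _ _ Xi] := Fgood _ FX.
    by apply: (Xi s c) => //; exact: sX.
have domG a : A a -> exists b, G (a, b).
  move=> Aa; apply: contrapT => /forallNP aN.
  have aT : mix G a by right.
  have [b [Bb bT]] : exists b, B b /\ b \notin lin_span (mix G `\ a).
    apply: contrapT => /forallNP bN; move: (lin_indep_notin Gind aT) => /negP; apply.
    apply: (@lin_span_min _ _ B) (Bspan a) => b Bb.
    by apply/negP => /negP bT; apply: (bN b).
  have GaN c : ~ G (c, a).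
    by move=> Gca; have [d] := Gdisj _ _ Aa Gca; exact: aN.
  have GbN c : ~ G (c, b).
    move=> Gcb; move/negP: bT; apply; apply: mem_lin_span; split; first by left; exists c.
    by move=> /= ba; apply: (GaN c); rewrite -ba.
  apply: (Gmax (G `|` [set (a, b)])).
    by split=> [p|/(_ (a, b) (or_intror erefl))]; [left|exact: aN].
  split.
  - by move=> c d [/GAB//|[-> ->]].
  - move=> c d c' d' [Gcd|[-> ->]] [Gcd'|[-> ->]] //; first exact: Ginj.
      split=> [ca|db]; first by case: (aN d); rewrite -ca.
      by case: (GbN c); rewrite -db.
    split=> [ac|bd]; first by case: (aN d'); rewrite ac.
    by case: (GbN c'); rewrite bd.
  - move=> c d Ad [Gcd|[_ db]].
      by have [d' Gd'] := Gdisj _ _ Ad Gcd; exists d'; left.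
    have [->|ba] := pselect (d = a); first by exists b; right.
    have [[e Gde]|/forallNP dN] := pselect (exists e, G (d, e)).
      by exists e; left.
    move/negP: bT; case; apply: mem_lin_span; rewrite -db; split=> //.
    by right.
  - apply: lin_indepS (lin_indepU1 _ bT); last first.
      by apply: lin_indepS Gind => x [].
    move=> x [[c [Gcx|[_ ->]]]|[Ax xN]]; [|by left|].
      right; split; first by left; exists c.
      by move=> /= xa; apply: (GaN c); rewrite -xa.
    right; split; first by right; split=> // c Gxc; apply: (xN c); left.
    by move=> /= xa; apply: (xN b); right; rewrite xa.
pose f a := if pselect (A a) is left Aa then projT1 (cid (domG a Aa)) else 0.
have fG a : A a -> G (a, f a).
  by rewrite /f; case: pselect => // Aa _; case: cid.
have fB a : A a -> B (f a) by move=> /fG/GAB[].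
have finj : {in A &, injective f}.
  by move=> a b /set_mem/fG Ga /set_mem/fG Gb /(Ginj _ _ _ _ Ga Gb).
rewrite -(card_le_eql (inj_card_eq finj)); apply: subset_card_le.
by move=> _ [a Aa <-]; exact: fB.
Qed.

Lemma basis_card (A B : set V) : is_basis A -> is_basis B -> (A #= B)%card.
Proof.
move=> Ab Bb; rewrite card_eq_le; apply/andP; split.
  exact: basis_card_le (proj1 Ab) Bb.
exact: basis_card_le (proj1 Bb) Ab.
Qed.

End Dimension.

(* A cardinal is represented by a type of that cardinality: the dimension of V
   is the index type of a chosen basis, unique up to bijection by [vdim_card]. *)
Definition vdim (K : fieldType) (V : lmodType K) : Type :=
  set_type (projT1 (cid (basis_exists V))).

Lemma vdim_card (K : fieldType) (V : lmodType K) (B : set V) :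
  is_basis B -> ([set: vdim V] #= B)%card.
Proof.
by rewrite /vdim; case: cid => A Ab Bb;
apply: card_eq_trans (basis_card Ab Bb); exact: card_setT.
Qed.

Record category := Category {
  obj :> Type;
  hom : obj -> obj -> Type;
  idm : forall a, hom a a;
  hcomp : forall a b c, hom b c -> hom a b -> hom a c;
  comp_idl : forall a b (f : hom a b), hcomp (idm b) f = f;
  comp_idr : forall a b (f : hom a b), hcomp f (idm a) = f;
  compA : forall a b c d (h : hom c d) (g : hom b c) (f : hom a b),
    hcomp h (hcomp g f) = hcomp (hcomp h g) f
}.

Definition connected_category (C : category) : Prop :=
  inhabited C /\
  forall a b : C, clos_refl_sym_trans C (fun x y => inhabited (hom x y)) a b.

Record vect_functor (K : fieldType) (C : category) := VectFunctor {
  fobj :> C -> lmodType K;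
  fmap : forall a b : C, hom a b -> {linear fobj a -> fobj b};
  fmap_id : forall (a : C) x, fmap (idm a) x = x;
  fmap_comp : forall (a b c : C) (g : hom b c) (f : hom a b) x,
    fmap (hcomp g f) x = fmap g (fmap f x)
}.

Definition functor_iso (K : fieldType) (C : category)
    (M N : vect_functor K C) : Prop :=
  exists phi : forall c : C, {linear M c -> N c},
    (forall c, bijective (phi c)) /\
    forall (a b : C) (f : hom a b) x, phi b (fmap M f x) = fmap N f (phi a x).

Section FunctorConstructions.
Variables (K : fieldType) (C : category).

Definition const_functor (V : lmodType K) : vect_functor K C :=
  @VectFunctor K C (fun=> V) (fun _ _ _ => idfun)
    (fun _ _ => erefl) (fun _ _ _ _ _ _ => erefl).

Section Binary.
Variables M N : vect_functor K C.

Definition fsum_map (a b : C) (f : hom a b) (x : M a * N a) : M b * N b :=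
  (fmap M f x.1, fmap N f x.2).

Lemma fsum_map_is_linear a b (f : hom a b) : linear (fsum_map f).
Proof. by move=> k x y; rewrite /fsum_map /= !linearP. Qed.

HB.instance Definition _ a b (f : hom a b) :=
  GRing.isLinear.Build K (M a * N a)%type (M b * N b)%type *:%R
    (fsum_map f) (fsum_map_is_linear f).

Lemma fsum_map_id a x : fsum_map (idm a) x = x.
Proof. by case: x => x y; rewrite /fsum_map /= !fmap_id. Qed.

Lemma fsum_map_comp (a b c : C) (g : hom b c) (f : hom a b) x :
  fsum_map (hcomp g f) x = fsum_map g (fsum_map f x).
Proof. by rewrite /fsum_map /= !fmap_comp. Qed.

Definition fsum : vect_functor K C :=
  @VectFunctor K C (fun c => (M c * N c)%type) (fun _ _ f => fsum_map f)
    fsum_map_id fsum_map_comp.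

End Binary.

Section Indexed.
Variables (I : Type) (F : I -> vect_functor K C).

Lemma fdsum_map_fin_supp (a b : C) (f : hom a b) (x : dsum (fun i => F i a)) :
  ((fun i => fmap (F i) f (dsum_coef x i)) : prodmod (fun i => F i b))
    \in @fin_supp K I (fun i => F i b).
Proof.
apply/asboolP; have /asboolP := submod_valP x; apply: sub_finite_set => i /=.
by apply: contraNneq => xi; rewrite /dsum_coef xi linear0.
Qed.

Definition fdsum_map (a b : C) (f : hom a b) (x : dsum (fun i => F i a)) :
  dsum (fun i => F i b) := Submod (fdsum_map_fin_supp f x).

Lemma fdsum_map_is_linear a b (f : hom a b) : linear (fdsum_map f).
Proof.
move=> k x y; apply: dsumP => i.
by rewrite /dsum_coef [in RHS]linearP /=; exact: linearP.
Qed.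

HB.instance Definition _ a b (f : hom a b) :=
  GRing.isLinear.Build K (dsum (fun i => F i a)) (dsum (fun i => F i b)) *:%R
    (fdsum_map f) (fdsum_map_is_linear f).

Lemma fdsum_map_id a x : fdsum_map (idm a) x = x.
Proof. by apply: dsumP => i; rewrite /dsum_coef /= fmap_id. Qed.

Lemma fdsum_map_comp (a b c : C) (g : hom b c) (f : hom a b) x :
  fdsum_map (hcomp g f) x = fdsum_map g (fdsum_map f x).
Proof. by apply: dsumP => i; rewrite /dsum_coef /= fmap_comp. Qed.

Definition fdsum : vect_functor K C :=
  @VectFunctor K C (fun c => dsum (fun i => F i c)) (fun _ _ f => fdsum_map f)
    fdsum_map_id fdsum_map_comp.

End Indexed.

Definition fcopies (I : Type) (F : vect_functor K C) : vect_functor K C :=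
  fdsum (fun _ : I => F).

End FunctorConstructions.

Section Limit.
Variables (K : fieldType) (C : category) (M : vect_functor K C).

Definition compatible : {pred prodmod M} := fun x =>
  `[< forall (a b : C) (f : hom a b), fmap M f (x a) = x b >].

Lemma compatible_submod : submod_closed compatible.
Proof.
split; first by apply/asboolP => a b f; exact: linear0.
move=> k x y /asboolP Hx /asboolP Hy; apply/asboolP => a b f.
by rewrite !prodmodDE !prodmodZE linearP Hx Hy.
Qed.

HB.instance Definition _ :=
  GRing.isSubmodClosed.Build K (prodmod M) compatible compatible_submod.

Definition vlim : lmodType K := submod compatible.

Definition lim_proj (c : C) (x : vlim) : M c := submod_val x c.

Lemma lim_proj_is_linear c : linear (lim_proj c).
Proof. by move=> k x y; rewrite /lim_proj linearP. Qed.

HB.instance Definition _ c :=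
  GRing.isLinear.Build K vlim (M c) *:%R (lim_proj c) (lim_proj_is_linear c).

Lemma lim_proj_nat (a b : C) (f : hom a b) x :
  fmap M f (lim_proj a x) = lim_proj b x.
Proof. by have /asboolP := submod_valP x; exact. Qed.

Lemma vlim_universal (W : lmodType K) (p : forall c : C, {linear W -> M c}) :
  (forall (a b : C) (f : hom a b) w, fmap M f (p a w) = p b w) ->
  exists h : {linear W -> vlim}, (forall c w, lim_proj c (h w) = p c w) /\
    forall h' : {linear W -> vlim}, (forall c w, lim_proj c (h' w) = p c w) ->
      h' =1 h.
Proof.
move=> pnat.
have pc w : ((fun c => p c w) : prodmod M) \in compatible.
  by apply/asboolP => a b f; exact: pnat.
pose h w : vlim := Submod (pc w).
have h_lin : linear h.
  move=> k x y; apply/val_inj; rewrite linearP; apply: prodmodP => c /=.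
  by rewrite prodmodDE prodmodZE linearP.
pose hL := GRing.isLinear.Build K W vlim *:%R h h_lin.
exists (HB.pack_for {linear W -> vlim} h hL); split=> // h' h'p w.
by apply/val_inj/prodmodP => c; exact: h'p.
Qed.

End Limit.

Section Colimit.
Variables (K : fieldType) (C : category) (M : vect_functor K C).

Definition colim_rel : set (dsum M) := fun r =>
  exists (a b : C) (f : hom a b) (x : M a),
    r = dinj (fmap M f x) - dinj x.

Definition vcolim : lmodType K := qspan colim_rel.

Definition colim_inj (c : C) (x : M c) : vcolim := qpi colim_rel (dinj x).

Lemma colim_inj_is_linear c : linear (@colim_inj c).
Proof. by move=> k x y; rewrite /colim_inj !linearP. Qed.

HB.instance Definition _ c :=
  GRing.isLinear.Build K (M c) vcolim *:%R (@colim_inj c)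
    (@colim_inj_is_linear c).

Lemma colim_inj_nat (a b : C) (f : hom a b) x :
  colim_inj (fmap M f x) = colim_inj x.
Proof. by apply/qpi_eq/mem_lin_span; exists a, b, f, x. Qed.

Lemma vcolim_universal (W : lmodType K) (p : forall c : C, {linear M c -> W}) :
  (forall (a b : C) (f : hom a b) x, p b (fmap M f x) = p a x) ->
  exists h : {linear vcolim -> W}, (forall c x, h (@colim_inj c x) = p c x) /\
    forall h' : {linear vcolim -> W},
      (forall c x, h' (@colim_inj c x) = p c x) -> h' =1 h.
Proof.
move=> pnat; have [g gE] := dsum_lift p.
have [|h hE] := @qspan_lift K (dsum M) colim_rel W g.
  by move=> _ [a [b [f [x ->]]]]; rewrite linearB /= !gE pnat subrr.
exists h; split=> [c x|h' h'E q]; first by rewrite hE gE.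
rewrite -(qreprK q) hE.
apply: (@dsum_ext _ _ _ W (h' \o qpi colim_rel) g) => c x /=.
by rewrite gE; exact: h'E.
Qed.

End Colimit.

Section Rank.
Variables (K : fieldType) (C : category) (conC : connected_category C).
Variable M : vect_functor K C.

Definition base_object : C :=
  inhabited_witness (proj1 conC).

Definition Psi : {linear vlim M -> vcolim M} :=
  @colim_inj K C M base_object \o @lim_proj K C M base_object.

Lemma PsiE (c : C) x : Psi x = colim_inj (lim_proj c x).
Proof.
have [_ zz] := conC.
rewrite /Psi /=; elim: (zz base_object c) => [a b [f]||a b _ ->//|a b d _ -> _ ->//] //.
by rewrite -(lim_proj_nat f) colim_inj_nat.
Qed.

Definition rk : Type := vdim (img Psi).

End Rank.

(* Main.v *)
From HB Require Import structures.
Require Import Defs.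
From mathcomp Require Import all_boot all_order all_algebra.
From mathcomp Require Import all_classical.
Import GRing.Theory Defs.
Local Open Scope classical_set_scope.
Local Open Scope ring_scope.
Set Implicit Arguments.
Unset Strict Implicit.

(** Let [V] be the free space on a basis of [im Psi_M].  Lifting the basis along
    [Psi_M] gives [s : V -> lim M] such that [Psi_M \o s] is injective with the
    same image as [Psi_M]; choose a linear retraction [r : colim M -> V] of it.
    The composites [V -> lim M -> M c -> colim M -> V] are then the identity and
    natural in [c], so the constant functor on [V] splits off [M], the complement
    [N] being the kernel of [p_c : M c -> colim M -> V].  A compatible family of
    [N] is one of [M] killed by [r \o Psi_M], hence by [Psi_M] since [r] is
    injective on [im Psi_M]; the projection [M -> N] transports this to
    [Psi_N]. *)

(** * Linear maps over a field: free spaces on bases, sections and retractions *)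

Section LinearAlgebra.
Variable K : fieldType.

Lemma linear_fun (U V : lmodType K) (f : U -> V) :
  linear f -> exists g : {linear U -> V}, g =1 f.
Proof.
move=> fL; pose m := GRing.isLinear.Build K U V *:%R f fL.
by exists (HB.pack_for {linear U -> V} f m).
Qed.

Lemma linear_inverse (U V : lmodType K) (f : {linear U -> V}) :
  injective f -> (forall v, exists u, f u = v) ->
  exists g : {linear V -> U}, cancel f g /\ cancel g f.
Proof.
move=> finj /choice[h hK].
have [|g gh] := @linear_fun V U h.
  by move=> a x y; apply: finj; rewrite linearP !hK.
exists g; split=> [u|v]; last by rewrite gh hK.
by apply: finj; rewrite gh hK.
Qed.

Lemma linear_inj (U V : lmodType K) (f : {linear U -> V}) :
  (forall u, f u = 0 -> u = 0) -> injective f.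
Proof.
move=> f0 x y fxy; apply/eqP; rewrite -subr_eq0; apply/eqP/f0.
by rewrite linearB fxy subrr.
Qed.

Lemma free_map (V : lmodType K) (I : Type) (g : I -> V) :
  exists f : {linear dsum (fun _ : I => K^o) -> V},
    forall i (k : K^o), f (dinj (V := fun _ => K^o) (i := i) k) = k *: g i.
Proof.
have /choice[h hE] : forall i : I, exists h : {linear K^o -> V},
    forall k, h k = k *: g i.
  move=> i; have [|h hE] := @linear_fun K^o V (fun k => k *: g i);
    last by exists h.
  by move=> a x y; rewrite scalerDl scalerA.
by have [f fE] := dsum_lift h; exists f => i k; rewrite fE hE.
Qed.

(** Independence of [B] gives injectivity, and spanning gives surjectivity. *)
Lemma basis_free_iso (V : lmodType K) (B : set V)
    (f : {linear dsum (fun _ : set_type B => K^o) -> V}) :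
  is_basis B ->
  (forall i (k : K^o), f (dinj (V := fun _ => K^o) (i := i) k) = k *: val i) ->
  injective f /\ forall v, exists u, f u = v.
Proof.
move=> [Bi Bs] fE; split.
  apply: linear_inj => x; have [s [us sx _]] := dsum_decomp x x.
  (* [lin_indep] wants coefficients on all of [V]; the default 0 outside [B] is never read, as the
     sum runs over elements of [B]. *)
  pose a v : K := if insub v is Some i then dsum_coef x i else 0.
  have aE (i : set_type B) : a (val i) = dsum_coef x i by rewrite /a valK.
  rewrite {1}(dsumE us sx) linear_sum => x0; apply: dsumP => i.
  have [si|/sx -> //] := boolP (i \in (s : seq {classic _})).
  rewrite -aE.
  apply: (Bi [seq val (i : set_type B) | i : {classic set_type B} <- s] a).
  - by rewrite map_inj_uniq// => i1 i2; exact: val_inj.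
  - by move=> _ /mapP[j _ ->]; exact/set_mem/valP.
  - by rewrite big_map -[RHS]x0; apply: eq_bigr => j _; rewrite fE aE.
  - exact: (map_f (fun i : {classic set_type B} => val (i : set_type B))).
move=> v; have : v \in in_img f.
  apply: lin_span_min (Bs v) => b Bb; apply/mem_set.
  exists (dinj (V := fun _ => K^o) (i := SigSub (mem_set Bb)) 1) => //.
  by rewrite fE scale1r.
by move=> /set_mem[u _ <-]; exists u.
Qed.

(** Choose preimages of basis vectors and extend linearly: [e'] takes coordinates and [t] sends the
    generators to these preimages, so [f \o t] is [e]. *)
Lemma linear_section (U V : lmodType K) (f : {linear U -> V}) :
  (forall v, exists u, f u = v) -> exists g : {linear V -> U}, cancel g f.
Proof.
move=> fsurj; have [B Bb] := basis_exists V.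
have [e eE] := free_map (fun i : set_type B => val i : V).
have [einj esurj] := basis_free_iso Bb eE.
have [e' [_ e'K]] := linear_inverse einj esurj.
have /choice[x xE] : forall i : set_type B, exists u, f u = val i.
  by move=> i; exact: fsurj.
have [t tE] := free_map x.
exists (t \o e') => v /=; rewrite -[RHS]e'K.
apply: (@dsum_ext _ _ _ _ (f \o t) e) => i k /=.
by rewrite tE eE linearZ /= xE.
Qed.

(** A section [t] of the quotient map by the image of [f] gives a complement of that image; [v]
    minus its component in the complement lies in the image and has a unique preimage under [f]. *)
Lemma linear_retraction (U V : lmodType K) (f : {linear U -> V}) :
  injective f -> exists g : {linear V -> U}, cancel f g.
Proof.
move=> finj.
have [|t tK] := @linear_section _ _ (@qpi K V (range f)).
  by move=> q; exists (qrepr q); exact: qreprK.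
have /choice[h hE] : forall v, exists u, f u = v - t (qpi (range f) v).
  move=> v.
  have /qpi_eq vt : qpi (range f) v = qpi (range f) (t (qpi (range f) v)).
    by rewrite tK.
  have : v - t (qpi (range f) v) \in in_img f.
    by apply: lin_span_min vt => w; exact: mem_set.
  by move=> /set_mem[u _ <-]; exists u.
(* The chosen preimages depend linearly on [v] because [f] is injective. *)
have [|g gh] := @linear_fun V U h.
  move=> a x y; apply: finj; rewrite linearP !hE [qpi _ (_ + _)]linearP linearP.
  by rewrite scalerBr opprD addrACA.
exists g => u; apply: finj; rewrite gh hE.
have -> : qpi (range f) (f u) = 0.
  rewrite -(linear0 (qpi (range f))); apply/qpi_eq/mem_lin_span.
  by rewrite subr0; exists u.
by rewrite linear0 subr0.
Qed.

End LinearAlgebra.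

(** * The kernel of a cocone, as a subfunctor *)

Section Kernel.
Variables (K : fieldType) (U V : lmodType K) (f : {linear U -> V}).

Definition in_ker : {pred U} := fun u => f u == 0.

Lemma ker_submod : submod_closed in_ker.
Proof.
split; first by rewrite unfold_in linear0.
move=> a u v; rewrite !unfold_in => /eqP fu /eqP fv.
by rewrite linearP fu fv scaler0 addr0.
Qed.

HB.instance Definition _ := GRing.isSubmodClosed.Build K U in_ker ker_submod.

End Kernel.

Section KernelFunctor.
Variables (K : fieldType) (C : category) (M : vect_functor K C).
Variables (V : lmodType K) (p : forall c : C, {linear M c -> V}).
Hypothesis p_nat :
  forall (a b : C) (f : hom a b) x, p b (fmap M f x) = p a x.

Lemma fker_map_subproof (a b : C) (f : hom a b) (x : submod (in_ker (p a))) :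
  fmap M f (submod_val x) \in in_ker (p b).
Proof. by rewrite unfold_in p_nat; exact: submod_valP x. Qed.

Definition fker_map (a b : C) (f : hom a b) (x : submod (in_ker (p a))) :
  submod (in_ker (p b)) := Submod (fker_map_subproof f x).

Lemma fker_map_is_linear (a b : C) (f : hom a b) : linear (fker_map f).
Proof. by move=> k x y; apply: val_inj; rewrite /= !linearP. Qed.

HB.instance Definition _ (a b : C) (f : hom a b) :=
  GRing.isLinear.Build K (submod (in_ker (p a))) (submod (in_ker (p b))) *:%R
    (fker_map f) (fker_map_is_linear f).

Lemma fker_map_id a x : fker_map (idm a) x = x.
Proof. by apply: val_inj; rewrite /= fmap_id. Qed.

Lemma fker_map_comp (a b c : C) (g : hom b c) (f : hom a b) x :
  fker_map (hcomp g f) x = fker_map g (fker_map f x).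
Proof. by apply: val_inj; rewrite /= fmap_comp. Qed.

Definition fker : vect_functor K C :=
  @VectFunctor K C (fun c => submod (in_ker (p c))) (fun _ _ f => fker_map f)
    fker_map_id fker_map_comp.

(** * Projection onto the kernel, and its effect on limits and colimits *)

Variable s : {linear V -> vlim M}.
Hypothesis s_section : forall c v, p c (lim_proj c (s v)) = v.

Lemma fker_proj_subproof c (x : M c) :
  x - lim_proj c (s (p c x)) \in in_ker (p c).
Proof. by rewrite unfold_in linearB /= s_section subrr. Qed.

Definition fker_proj c (x : M c) : fker c := Submod (fker_proj_subproof x).

Lemma fker_proj_is_linear c : linear (@fker_proj c).
Proof.
move=> k x y; apply: val_inj.
rewrite [RHS]linearP /= [p c _]linearP [s _]linearP [lim_proj c _]linearP.
by rewrite scalerBr opprD addrACA.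
Qed.

HB.instance Definition _ c :=
  GRing.isLinear.Build K (M c) (fker c) *:%R (@fker_proj c)
    (@fker_proj_is_linear c).

Lemma fker_proj_nat (a b : C) (f : hom a b) x :
  fker_proj (fmap M f x) = fmap fker f (fker_proj x).
Proof. by apply: val_inj; rewrite /= p_nat linearB /= lim_proj_nat. Qed.

Lemma fker_projK c (n : fker c) : fker_proj (submod_val n) = n.
Proof.
apply: val_inj; rewrite /=; have /eqP -> := submod_valP n.
by rewrite !linear0 addr0.
Qed.

(** The isomorphism pairs [p] with the complementary projection. A general [P] is allowed because
    copies of a constant functor are constant only up to natural isomorphism. *)
Lemma fker_split (P : vect_functor K C) (w : forall c, {linear V -> P c}) :
  (forall c, bijective (w c)) ->
  (forall (a b : C) (f : hom a b) v, w b v = fmap P f (w a v)) ->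
  functor_iso M (fsum P fker).
Proof.
move=> w_bij w_nat.
pose phi c (x : M c) : fsum P fker c := (w c (p c x), fker_proj x).
have phi_lin c : linear (@phi c).
  by move=> k x y; rewrite /phi !linearP.
pose phiL c :=
  GRing.isLinear.Build K (M c) (fsum P fker c) *:%R (@phi c) (phi_lin c).
exists (fun c => HB.pack_for {linear M c -> fsum P fker c} (@phi c) (phiL c)).
split=> [c|a b f x]; last first.
  by rewrite /= /phi /fsum_map /= p_nat -w_nat fker_proj_nat.
have [w' wK w'K] := w_bij c.
exists (fun y => lim_proj c (s (w' y.1)) + submod_val y.2) => [x|[v n]] /=.
  by rewrite wK addrC subrK.
have pn : p c (submod_val n) = 0 by apply/eqP; exact: submod_valP n.
rewrite /phi linearD /= s_section pn addr0 w'K; congr pair.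
by apply: val_inj; rewrite /= linearD /= s_section pn addr0 addrC addKr.
Qed.

Lemma fker_lim (y : vlim fker) :
  exists x : vlim M, forall c, lim_proj c x = submod_val (lim_proj c y).
Proof.
have xP :
    ((fun c => submod_val (lim_proj c y)) : prodmod M) \in @compatible K C M.
  by apply/asboolP => a b f; rewrite -(lim_proj_nat f y).
by exists (Submod xP).
Qed.

(** The map induced by [fker_proj], which fixes the kernel pointwise. *)
Lemma fker_colim :
  exists h : {linear vcolim M -> vcolim fker},
    forall c (n : fker c), h (colim_inj (submod_val n)) = colim_inj n.
Proof.
have [|h [hE _]] := @vcolim_universal K C M (vcolim fker)
    (fun c => @colim_inj K C fker c \o @fker_proj c).
  by move=> a b f x /=; rewrite fker_proj_nat colim_inj_nat.
by exists h => c n; rewrite hE /= fker_projK.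
Qed.

End KernelFunctor.

(** On generators, hence everywhere, [Psi \o s] is the isomorphism [e] onto the image followed by
    inclusion. Injectivity and surjectivity of [e] give the two claims. *)
Lemma Psi_free_lift (K : fieldType) (C : category)
    (conC : connected_category C) (M : vect_functor K C) :
  exists s : {linear dsum (fun _ : rk conC M => K^o) -> vlim M},
    injective (Psi conC M \o s) /\
    forall x, exists v, Psi conC M x = Psi conC M (s v).
Proof.
(* Exposes the basis behind [rk], so that the index type becomes [set_type B]. *)
rewrite /rk /vdim; case: (cid _) => B Bb; rewrite [projT1 _]/=.
have /choice[x xE] : forall i : set_type B,
    exists x, Psi conC M x = submod_val (val i).
  by move=> i; have /set_mem[x _ xE] := submod_valP (val i); exists x.
have [e eE] := free_map (fun i : set_type B => val i : img (Psi conC M)).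
have [einj esurj] := basis_free_iso Bb eE.
have [s sE] := free_map x.
have PsE v : Psi conC M (s v) = submod_val (e v).
  apply: (@dsum_ext _ _ _ _ (Psi conC M \o s) (@submod_val _ _ _ \o e)) => i k.
  transitivity (k *: Psi conC M (x i)); first by rewrite /= sE !linearZ.
  by rewrite xE /= eE linearZ.
exists s; split=> [u v uv|y].
  by apply/einj/val_inj; rewrite -[LHS]PsE -[RHS]PsE.
have yP : Psi conC M y \in in_img (Psi conC M) by apply/mem_set; exists y.
by have [v vE] := esurj (Submod yP); exists v; rewrite PsE vE.
Qed.

Theorem theorem3p2 (K : fieldType) (C : category) (conC : connected_category C)
    (M : vect_functor K C) :
  exists N : vect_functor K C,
    functor_iso M (fsum (fcopies (rk conC M) (const_functor C K^o)) N) /\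
    range (Psi conC N) = [set 0].
Proof.
have [s [Ps_inj Ps_img]] := Psi_free_lift conC M.
have [r rK] := linear_retraction Ps_inj.
pose p c : {linear M c -> _} := r \o @colim_inj K C M c.
have p_nat (a b : C) (f : hom a b) x : p b (fmap M f x) = p a x.
  by rewrite /= colim_inj_nat.
have p_section c v : p c (lim_proj c (s v)) = v.
  by rewrite /= -(PsiE conC); exact: rK.
exists (fker p_nat); split.
  pose F := dsum (fun _ : rk conC M => K^o).
  (* At each object the copies of the constant functor are [F] by conversion, so the identity
     typechecks. *)
  pose w c : {linear F -> fcopies (rk conC M) (const_functor C K^o) c} :=
    (idfun : {linear F -> F}).
  apply: (fker_split p_nat p_section (w := w)) => [c|a b f v].
    by exists idfun.
  by apply: dsumP => i.
apply/seteqP; split=> [_ [y _ <-]|_ ->] /=; last by exists 0; rewrite ?linear0.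
have [x xE] := fker_lim y.
have [h hE] := fker_colim p_nat p_section.
pose c := base_object conC.
have Px0 : Psi conC M x = 0.
  have [v vE] := Ps_img x.
  suff v0 : v = 0 by rewrite vE v0 !linear0.
  (* Here [v] is [r (Psi x)], that is [p c] applied to the component of [y] at [c], which lies in
     the kernel. *)
  rewrite -[LHS]rK -[_ v]/(Psi conC M (s v)) -vE (PsiE conC c) xE; apply/eqP.
  exact: submod_valP (lim_proj c y).
(* Writes [Psi y] for the kernel functor as [h (Psi x)]. *)
apply: (etrans (PsiE conC c y)); rewrite -hE -xE -(PsiE conC c) Px0.
exact: linear0.
Qed.
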